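(* Let $G$ be a finite simple graph with edge weight function $w$ and vertex weight function $w_1$, and let $\theta$ be a real number. Let $u$ be a $(\theta,w,w_1)$-special vertex of $G$. Then for every vertex $v$ of $G\setminus u$, $v$ is $(\theta,w,w_1)$-essential in $G\setminus u$ if and only if $v$ is $(\theta,w,w_1)$-essential in $G$.
   Context: An edge weight function $w$ assigns a nonzero complex number $w(e)$ to each edge $e$; a vertex weight function $w_1$ assigns a real number $w_1(u)$ (possibly $0$) to each vertex $u$. Subgraphs (obtained by deleting vertices or edges) carry the restricted weights. $G\setminus u$ denotes $G$ with the vertex $u$ and its incident edges deleted. For $A\subseteq E(G)$ put $w(A)=\prod_{e\in A}w(e)$. The edge weighted matching polynomial is $\mu_w(G,x)=\sum_{M}(-1)^{|M|}|w(M)|^2x^{n-2|M|}$, summed over all matchings $M$ of $G$ (including the empty matching), $n=|V(G)|$. The weighted matching polynomial is $\eta_{(w,w_1)}(G,x)=\sum_{S\subseteq V(G)}(-1)^{|V(G)\setminus S|}\big(\prod_{u\in V(G)\setminus S}w_1(u)\big)\mu_w(G[S],x)$, where $G[S]$ is the induced subgraph on $S$, $\mu_w$ of the empty graph is $1$, and $\eta_{(w,w_1)}$ of the empty graph is $1$. Write $\mathrm{mult}(\theta,H)$ for the multiplicity of $\theta$ as a root of $\eta_{(w,w_1)}(H,x)$ ($0$ if not a root). A vertex $u$ of $H$ is $(\theta,w,w_1)$-essential if $\mathrm{mult}(\theta,H\setminus u)=\mathrm{mult}(\theta,H)-1$, $(\theta,w,w_1)$-neutral if $\mathrm{mult}(\theta,H\setminus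 u)=\mathrm{mult}(\theta,H)$, $(\theta,w,w_1)$-positive if $\mathrm{mult}(\theta,H\setminus u)=\mathrm{mult}(\theta,H)+1$; $u$ is $(\theta,w,w_1)$-special if it is not $(\theta,w,w_1)$-essential but is adjacent to some $(\theta,w,w_1)$-essential vertex of $H$. *)

(* Defs.v *)
From HB Require Import structures.
From mathcomp Require Import all_boot all_order all_algebra.
From mathcomp Require Import complex.
From mathcomp Require Import reals.
Set Implicit Arguments. Unset Strict Implicit. Unset Printing Implicit Defensive.
Import Order.TTheory GRing.Theory Num.Theory.
Local Open Scope ring_scope.

Section WMP.
Variables (R : realType) (T : finType) (e : rel T).
Variables (w : {set T} -> R[i]) (w1 : T -> R).

Definition is_edge (A : {set T}) : bool :=
  [exists x, exists y, e x y && (A == [set x; y])].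

Definition is_matching (S : {set T}) (M : {set {set T}}) : bool :=
  [forall A in M, is_edge A && (A \subset S)] && trivIset M.

Definition mu_w (S : {set T}) : {poly R[i]} :=
  \sum_(M : {set {set T}} | is_matching S M)
     ((-1) ^+ #|M| * \prod_(A in M) (`|w A| ^+ 2)) *: 'X^(#|S| - 2 * #|M|).

Definition eta_w (S : {set T}) : {poly R[i]} :=
  \sum_(S' : {set T} | S' \subset S)
     ((-1) ^+ #|S :\: S'| * \prod_(x in S :\: S') ((w1 x)%:C)%C) *: mu_w S'.

Definition mult (theta : R) (S : {set T}) : nat := mup ((theta%:C)%C) (eta_w S).

Definition essential (theta : R) (S : {set T}) (v : T) : bool :=
  (v \in S) && ((mult theta (S :\ v)).+1 == mult theta S).

Definition special (theta : R) (S : {set T}) (u : T) : bool :=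
  [&& u \in S, ~~ essential theta S u &
      [exists v in S, e u v && essential theta S v]].

End WMP.

(* Main.v *)
(** Deleting [i] from [S] gives a continued fraction: with A = S \ i,
    [eta S / eta A = X - w1 i - \sum_j |w ij|^2 / (eta A / eta (A \ j))].
    The Wronskian of [eta S] and [eta A], and the Heilmann-Lieb expression
    [eta (S \ i) eta (S \ u) - eta S eta (S \ i \ u)], unfold along this recurrence
    into sums of squares, and a sum of squares vanishes to order m at theta only
    if each of its terms does.  The first fact gives interlacing, and that a
    neighbour of [u] which is essential in [S \ u] makes [u] positive.  The
    second shows that if [z] is essential in [S] and [U] is a set of
    non-essential vertices, then the paths from [z] to [U] do not contribute to
    the value at theta of the continued fraction at [z], so [z] is still
    essential in [S \ U].

    Let [z] be an essential neighbour of the special vertex [u].  Taking U = {u},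
    [u] is positive, and interlacing settles the case of an essential [v].
    If [v] is not essential, taking U = {u, v} shows that [u] is positive in
    [G \ v], so mult (G \ u \ v) = mult (G \ v) + 1 >= mult (G \ u). *)

Require Import Defs.
From HB Require Import structures.
From mathcomp Require Import all_boot all_order all_algebra.
From mathcomp Require Import complex.
From mathcomp Require Import reals.
From mathcomp Require Import ring zify.
Import Order.TTheory GRing.Theory Num.Theory.
Local Open Scope ring_scope.

Set Implicit Arguments. Unset Strict Implicit. Unset Printing Implicit Defensive.

(** * Recurrences for matching polynomials *)

Section Matchings.
Variables (T : finType) (e : rel T).
Hypotheses (e_sym : symmetric e) (e_irr : irreflexive e).
Implicit Types (S A : {set T}) (M : {set {set T}}).

Lemma edge_neq u j : e u j -> u != j.
Proof. by apply: contraTneq => ->; rewrite e_irr. Qed.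

Lemma is_edge_set2 u j : e u j -> is_edge e [set u; j].
Proof. by move=> euj; apply/existsP; exists u; apply/existsP; exists j; rewrite euj eqxx. Qed.

Lemma edge_at A u : is_edge e A -> u \in A -> exists2 j, e u j & A = [set u; j].
Proof.
case/existsP=> x /existsP[y /andP[exy /eqP->]]; rewrite !inE => /orP[]/eqP->.
  by exists y.
by exists x; rewrite 1?e_sym // setUC.
Qed.

Lemma set2_inj u : injective (fun j : T => [set u; j]).
Proof.
move=> j k /setP E; have := E k; have := E j; rewrite !inE !eqxx !orbT => /esym.
by case/orP=> /eqP -> //; rewrite orbb => /eqP ->.
Qed.

Lemma card_edge A : is_edge e A -> #|A| = 2%N.
Proof.
by case/existsP=> x /existsP[y /andP[/edge_neq nxy /eqP->]]; rewrite cards2 nxy.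
Qed.

Lemma matchingP S M : reflect
  [/\ {in M, forall A, is_edge e A}, {in M, forall A, A \subset S} & trivIset M]
  (is_matching e S M).
Proof.
apply: (iffP andP) => [[/forall_inP H ?]|[H1 H2 ?]].
  by split=> // A /H /andP[].
by split=> //; apply/forall_inP => A AM; rewrite H1 ?H2.
Qed.

Lemma matching_card S M : is_matching e S M -> (2 * #|M| <= #|S|)%N.
Proof.
case/matchingP=> H1 H2 tM.
have <- : #|cover M| = (2 * #|M|)%N.
  rewrite mulnC -sum_nat_const; move/eqP: tM => <-.
  by apply: eq_bigr => A /H1; exact: card_edge.
by apply/subset_leq_card/bigcupsP => A /H2.
Qed.

Lemma matching_avoid S M u :
  is_matching e S M && (u \notin cover M) = is_matching e (S :\ u) M.
Proof.
apply/andP/matchingP => [[/matchingP[H1 H2 H3] uM]|[H1 H2 H3]].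
  split=> // A AM; rewrite subsetD1 H2 //=; apply: contra uM => uA.
  by apply/bigcupP; exists A.
split.
  apply/matchingP; split=> // A /H2; rewrite subsetD1; by case/andP.
by apply/negP => /bigcupP[A /H2]; rewrite subsetD1 => /andP[_ /negP].
Qed.

Lemma matching_add S M u j : u \in S -> j \in S -> e u j ->
  is_matching e S ([set u; j] |: M) && ([set u; j] \notin M)
  = is_matching e (S :\ u :\ j) M.
Proof.
move=> uS jS euj; have nuj := edge_neq euj.
apply/andP/matchingP => [[/matchingP[H1 H2 /trivIsetP H3] nM]|[H1 H2 H3]].
  split.
  - by move=> A AM; apply: H1; rewrite setU1r.
  - move=> A AM; have AM' : A \in [set u; j] |: M by rewrite setU1r.
    have := H3 _ _ (setU11 _ _) AM'; rewrite eq_sym.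
    have -> : A != [set u; j] by apply: contraNneq nM => <-.
    move/(_ isT); rewrite !subsetD1 H2 //= => /disjointFr d.
    by rewrite !d ?inE ?eqxx ?orbT.
  - by apply/trivIsetP => A B AM BM; apply: H3; rewrite setU1r.
have dj A : A \in M -> (u \notin A) && (j \notin A).
  by move/H2; rewrite !subsetD1 => /andP[/andP[_ ->] ->].
have nM : [set u; j] \notin M.
  by apply/negP => /dj; rewrite !inE eqxx.
(* [trivIset] tolerates an empty block, [trivIsetU1] does not. *)
have n0 : set0 \notin M.
  by apply/negP => /H1 /card_edge; rewrite cards0.
split=> //; apply/matchingP; split.
- by move=> A /setU1P[->|/H1//]; exact: is_edge_set2.
- move=> A /setU1P[->|/H2]; last by rewrite !subsetD1 => /andP[/andP[]].
  by apply/subsetP => x; rewrite !inE => /orP[]/eqP->.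
- suff d : {in M, forall B : {set T}, [disjoint [set u; j] & B]} by have [] := trivIsetU1 d H3 n0.
  move=> B BM; rewrite -setI_eq0; apply/eqP/setP => x; rewrite !inE.
  case/andP: (dj _ BM) => /negbTE uB /negbTE jB.
  by case: eqP => [->|_]; [|case: eqP => [->|]] => //=; rewrite ?uB ?jB.
Qed.

(** A matching either avoids [u] or matches it with a unique neighbour [j]; removing the edge [uj]
    is then a bijection onto the matchings that avoid both ends. *)
Lemma sum_matching (V : zmodType) S u (F : {set {set T}} -> V) : u \in S ->
  \sum_(M | is_matching e S M) F M =
  \sum_(M | is_matching e (S :\ u) M) F M +
  \sum_(j in S :\ u | e u j)
    \sum_(M | is_matching e (S :\ u :\ j) M) F ([set u; j] |: M).
Proof.
move=> uS; rewrite (bigID (fun M => u \notin cover M)) /=; congr (_ + _).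
  by apply: eq_bigl => M; rewrite matching_avoid.
(* The partner of [u] in [M]; the default is never taken when [M] covers [u]. *)
pose p M := odflt u [pick j | [set u; j] \in M].
have pP M : is_matching e S M -> u \in cover M ->
    [/\ [set u; p M] \in M, e u (p M) & p M \in S].
  move=> /matchingP[H1 H2 H3] /bigcupP[A AM uA].
  have [j euj EA] := edge_at (H1 _ AM) uA.
  rewrite /p; case: pickP => [k kM|/(_ j)]; last by rewrite -EA AM.
  have := H2 _ kM; rewrite subUset !sub1set => /andP[_ kS].
  split=> //=; have [l eul /set2_inj->//] := edge_at (H1 _ kM) (setU11 _ _).
rewrite (partition_big p (fun j => (j \in S :\ u) && e u j)) /=; last first.
  move=> M /andP[mM]; rewrite negbK => /(pP _ mM)[_ eup pS].
  by rewrite !inE eq_sym edge_neq // pS.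
apply: eq_bigr => j /andP[]; rewrite !inE => /andP[_ jS] euj.
rewrite (reindex_onto (fun M => [set u; j] |: M) (fun M => M :\ [set u; j])) /=.
  apply: eq_bigl => M; rewrite -(matching_add M uS jS euj).
  have -> : ([set u; j] |: M) :\ [set u; j] == M = ([set u; j] \notin M).
    apply/eqP/idP => [<-|/setU1K//]; by rewrite setD11.
  case mM: (is_matching _ _ _) => //=; rewrite negbK.
  have uM : u \in cover ([set u; j] |: M).
    by apply/bigcupP; exists [set u; j]; rewrite ?setU11.
  rewrite uM /=; have [pM _ _] := pP _ mM uM.
  case/matchingP: mM => _ _ /trivIsetP H3.
  suff -> : p ([set u; j] |: M) = j by rewrite eqxx.
  apply/set2_inj/eqP; apply: contraT => /(H3 _ _ pM (setU11 _ _)).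
  by move/disjointFr/(_ (setU11 _ _)); rewrite setU11.
move=> M /andP[/andP[mM]]; rewrite negbK => /(pP _ mM)[pM _ _] /eqP Ep.
by rewrite setD1K // -Ep.
Qed.

End Matchings.

Section WeightedMatchingPolynomial.
Variables (R : comNzRingType) (T : finType) (e : rel T).
Hypotheses (e_sym : symmetric e) (e_irr : irreflexive e).
Variables (c : {set T} -> R) (a : T -> R).
Implicit Type S : {set T}.

(** The weights [c], in place of the squared moduli, lie in an arbitrary ring, so that the sums of
    squares can be handled over the reals. *)
Definition matching_poly S : {poly R} :=
  \sum_(M : {set {set T}} | is_matching e S M)
     ((-1) ^+ #|M| * \prod_(A in M) c A) *: 'X^(#|S| - 2 * #|M|).

Definition vweight S : R := (-1) ^+ #|S| * \prod_(x in S) a x.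

Definition wmatching_poly S : {poly R} :=
  \sum_(S' : {set T} | S' \subset S) vweight (S :\: S') *: matching_poly S'.

Lemma matching_poly_rec S u : u \in S ->
  matching_poly S = 'X * matching_poly (S :\ u) -
    \sum_(j in S :\ u | e u j) c [set u; j] *: matching_poly (S :\ u :\ j).
Proof.
move=> uS; rewrite /matching_poly (sum_matching e_sym e_irr _ uS).
have cS := cardsD1 u S; rewrite uS in cS.
congr (_ + _).
  (* The bound [le] keeps the subtraction in the exponent from being truncated. *)
  rewrite mulr_sumr; apply: eq_bigr => M /(matching_card e_irr) le.
  rewrite -scalerAr -exprS; congr (_ *: 'X^_); lia.
rewrite -sumrN; apply: eq_bigr => j /andP[jS euj].
rewrite scaler_sumr -sumrN; apply: eq_bigr => M mM.
move: jS (mM); rewrite in_setD1 => /andP[nju jS].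
rewrite -(matching_add e_irr _ uS jS euj) => /andP[_ nM].
rewrite big_setU1 // cardsU1 nM scalerA -scaleNr; congr (_ *: 'X^_).
  by rewrite exprS mulN1r mulNr mulrCA.
have := cardsD1 j (S :\ u); rewrite !inE nju jS; lia.
Qed.

Lemma vweightU1 u S : u \notin S -> vweight (u |: S) = - a u * vweight S.
Proof.
by move=> uS; rewrite /vweight cardsU1 uS big_setU1 // exprS mulN1r !mulNr mulrCA.
Qed.

Lemma sum_subsets (V : zmodType) S u (F : {set T} -> V) : u \in S ->
  \sum_(S' : {set T} | S' \subset S) F S' =
  \sum_(S' : {set T} | S' \subset S :\ u) F S' +
  \sum_(S' : {set T} | S' \subset S :\ u) F (u |: S').
Proof.
move=> uS; rewrite (bigID (fun S' : {set T} => u \notin S')) /=; congr (_ + _).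
  by apply: eq_bigl => S'; rewrite subsetD1.
rewrite (reindex_onto (fun S' => u |: S') (fun S' => S' :\ u)) /=.
  apply: eq_bigl => S'; rewrite setU11 andbT subUset sub1set uS subsetD1 /=.
  congr (_ && _); apply/eqP/idP => [<-|/setU1K//]; by rewrite setD11.
by move=> S' /andP[_]; rewrite negbK => /setD1K.
Qed.

(** The subsets that avoid [u] produce the term in [a u]; those that contain it are expanded at [u]
    by [matching_poly_rec]. *)
Lemma wmatching_poly_rec S u : u \in S ->
  wmatching_poly S = ('X - (a u)%:P) * wmatching_poly (S :\ u) -
    \sum_(j in S :\ u | e u j) c [set u; j] *: wmatching_poly (S :\ u :\ j).
Proof.
move=> uS; rewrite /wmatching_poly (sum_subsets _ uS).
have E1 : \sum_(S' : {set T} | S' \subset S :\ u)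
     vweight (S :\: S') *: matching_poly S' = - (a u)%:P * wmatching_poly (S :\ u).
  rewrite mulr_sumr; apply: eq_bigr => S'; rewrite subsetD1 => /andP[_ uS'].
  have -> : S :\: S' = u |: (S :\ u :\: S').
    by apply/setP => x; rewrite !inE; case: (eqVneq x u) => [->|]; rewrite ?uS'.
  rewrite vweightU1 ?inE ?eqxx ?andbF // -scalerA mulNr scaleNr.
  by rewrite mul_polyC.
rewrite E1 mulrBl mulNr [RHS]addrAC [RHS]addrC; congr (_ + _).
rewrite mulr_sumr.
have -> : \sum_(j in S :\ u | e u j) c [set u; j] *: wmatching_poly (S :\ u :\ j)
  = \sum_(S' : {set T} | S' \subset S :\ u) vweight (S :\ u :\: S') *:
     \sum_(j in S' | e u j) c [set u; j] *: matching_poly (S' :\ j).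
  (* Double counting of the pairs of a subset [S'] and a neighbour [j] in it, with [S' :\ j] as the
     new index. *)
  under [RHS]eq_bigr do rewrite scaler_sumr.
  rewrite (exchange_big_dep (fun j => (j \in S :\ u) && e u j)) /=; last first.
    by move=> S' j sS /andP[jS' ->]; rewrite (subsetP sS).
  apply: eq_bigr => j /andP[jS euj]; rewrite scaler_sumr.
  rewrite [RHS](reindex_onto (fun S' => j |: S') (fun S' => S' :\ j)) /=; last first.
    by move=> S' /and3P[_ /setD1K].
  apply: eq_big => [S'|S' sS'].
    rewrite setU11 euj !andbT subUset sub1set jS /= [LHS]subsetD1.
    congr (_ && _); apply/idP/eqP => [/setU1K//|<-]; by rewrite setD11.
  rewrite setU1K; last by move: sS'; rewrite subsetD1 => /andP[].
  rewrite !scalerA mulrC; congr (_ * _ *: _); congr vweight.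
  by apply/setP => x; rewrite !inE; case: (eqVneq x j); rewrite ?andbF.
rewrite -sumrB; apply: eq_bigr => S'; rewrite subsetD1 => /andP[_ uS'].
rewrite (@matching_poly_rec (u |: S') u) ?setU11 // setU1K // scalerBr.
by rewrite -scalerAr setDDl.
Qed.

Lemma wmatching_poly0 : wmatching_poly set0 = 1.
Proof.
rewrite /wmatching_poly (big_pred1 set0) => [|S]; last by rewrite subset0.
rewrite /vweight setDv cards0 big_set0 mulr1 scale1r /matching_poly.
rewrite (big_pred1 set0) => [|M]; first by rewrite !cards0 big_set0 mulr1 scale1r.
apply/idP/eqP => [/(matching_card e_irr)|->].
  by rewrite cards0 leqn0 muln_eq0 /= cards_eq0 => /eqP.
by apply/matchingP; split=> [A|A|]; rewrite ?inE //; apply/trivIsetP => A B; rewrite inE.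
Qed.

End WeightedMatchingPolynomial.

(** Only the first term of the recurrence reaches the top degree. This serves to show that the
    polynomials are nonzero, so that multiplicities add up in products. *)
Lemma size_wmatching_poly (R : idomainType) (T : finType) (e : rel T)
    (c : {set T} -> R) (a : T -> R) (S : {set T}) :
  symmetric e -> irreflexive e -> size (wmatching_poly e c a S) = #|S|.+1.
Proof.
move=> e_sym e_irr; have [n] := ubnP #|S|; elim: n S => // n IH S le.
have [->|[u uS]] := set_0Vmem S; first by rewrite wmatching_poly0 // size_poly1 cards0.
have cS := cardsD1 u S; rewrite uS /= in cS.
have sA : size (wmatching_poly e c a (S :\ u)) = #|S| by rewrite IH; lia.
have sXA : size (('X - (a u)%:P) * wmatching_poly e c a (S :\ u)) = #|S|.+1.
  rewrite mulrC size_Mmonic ?monicXsubC ?size_XsubC ?sA ?addn2 //.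
  by rewrite -size_poly_eq0 sA cS.
rewrite (wmatching_poly_rec e_sym e_irr _ _ uS) size_polyDl ?sXA // size_polyN ltnS.
apply: (leq_trans (size_sum _ _ _)); apply/bigmax_leqP => j /andP[jS _].
apply: (leq_trans (size_scale_leq _ _)).
have := cardsD1 j (S :\ u); rewrite jS => cSj.
by rewrite IH; lia.
Qed.

(** * Order of vanishing of sums of squares *)

Section SumsOfSquares.
Variable R : rcfType.
Implicit Types (p q : {poly R}) (s : seq {poly R}).

Definition sos p := exists s, p = \sum_(q <- s) q ^+ 2.

Lemma sos_sqr p : sos (p ^+ 2).
Proof. by exists [:: p]; rewrite big_seq1. Qed.

Lemma sosD p q : sos p -> sos q -> sos (p + q).
Proof. by move=> [s ->] [t ->]; exists (s ++ t); rewrite big_cat. Qed.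

Lemma sosZ (a : R) p : 0 <= a -> sos p -> sos (a *: p).
Proof.
move=> a0 [s ->]; exists [seq Num.sqrt a *: q | q <- s].
rewrite big_map scaler_sumr; apply: eq_bigr => q _.
by rewrite exprZn sqr_sqrtr.
Qed.

Lemma sos_sum (I : finType) (P : pred I) (F : I -> {poly R}) :
  (forall i, P i -> sos (F i)) -> sos (\sum_(i | P i) F i).
Proof.
by move=> h; apply: (big_ind sos) => //; [exists [::]; rewrite big_nil | exact: sosD].
Qed.

Variable x : R.
Local Notation Lx := ('X - x%:P).

(** If a sum of squares vanishes at [x], so does each term, and dividing the terms by [Lx] lowers
    the order of the sum by two. An odd order is rounded up; interlacing depends on this gain. *)
Lemma dvdp_sum_sqr m s q : Lx ^+ m %| \sum_(r <- s) r ^+ 2 -> q \in s ->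
  Lx ^+ uphalf m %| q.
Proof.
elim/ltn_ind: m s q => -[|m] IH s q dS qs; first exact: dvd1p.
have all0 r : r \in s -> r.[x] = 0.
  have /rootP : root (\sum_(r <- s) r ^+ 2) x.
    by rewrite -dvdp_XsubCl; apply: dvdp_trans dS; rewrite exprS dvdp_mulr.
  rewrite horner_sum => /eqP.
  rewrite psumr_eq0 => [/allP h /h /=|r' _]; last by rewrite horner_exp sqr_ge0.
  by rewrite horner_exp sqrf_eq0 => /eqP.
have Ediv r : r \in s -> r = Lx * (r %/ Lx).
  by move=> /all0 r0; rewrite mulrC divpK // dvdp_XsubCl; apply/rootP.
rewrite (Ediv q qs); case: m => [|m] in IH dS *; first by rewrite dvdp_mulr.
rewrite -[uphalf _]/(uphalf m).+1 exprS dvdp_mul2l ?polyXsubC_eq0 //.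
apply: (IH _ _ [seq r %/ Lx | r <- s]) => //; last by apply/mapP; exists q.
have E : \sum_(r <- s) r ^+ 2 = Lx ^+ 2 * \sum_(r <- s) (r %/ Lx) ^+ 2.
  rewrite mulr_sumr !big_seq; apply: eq_bigr => r rs.
  by rewrite {1}(Ediv r rs) exprMn.
rewrite big_map; move: dS.
by rewrite E -addn2 addnC exprD dvdp_mul2l // expf_neq0 ?polyXsubC_eq0.
Qed.

Lemma dvdp_sosl m p q : sos p -> sos q -> Lx ^+ m %| p + q -> Lx ^+ m %| p.
Proof.
move=> [s ->] [t ->]; rewrite -big_cat => d; rewrite big_seq.
apply: (big_ind (fun r => Lx ^+ m %| r)) => [||r rs]; [exact: dvdp0 | exact: dvdp_add |].
have /dvdp_sum_sqr - /(_ r) := d; rewrite mem_cat rs => /(_ isT) dr.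
apply: (@dvdp_trans _ ((Lx ^+ uphalf m) ^+ 2)); last by rewrite dvdp_exp2r.
by rewrite -exprM dvdp_exp2l //; lia.
Qed.

Lemma dvdp_sqr m p : Lx ^+ m %| p ^+ 2 -> Lx ^+ uphalf m %| p.
Proof. by move=> d; apply: (@dvdp_sum_sqr _ [:: p]); rewrite ?big_seq1 ?mem_head. Qed.

Lemma dvdp_sos_sum m (I : finType) (P : pred I) (F : I -> {poly R}) (a : I -> R) :
  (forall i, P i -> 0 < a i) -> (forall i, P i -> sos (F i)) ->
  Lx ^+ m %| \sum_(i | P i) a i *: F i -> forall i, P i -> Lx ^+ m %| F i.
Proof.
move=> a0 hF d i Pi; have ai := a0 i Pi.
rewrite -(@dvdpZr _ (a i)) ?gt_eqF //.
move: d; rewrite (bigD1 i) //= => /dvdp_sosl; apply.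
  by apply: sosZ; [exact: ltW | exact: hF].
by apply: sos_sum => j /andP[Pj _]; apply: sosZ; [exact/ltW/a0 | exact: hF].
Qed.

Lemma dvdp_deriv n p : Lx ^+ n %| p -> Lx ^+ n.-1 %| p^`().
Proof.
case: n => [|n] /dvdpP[q ->]; first exact: dvd1p.
rewrite derivM deriv_exp /= dvdp_add //.
  by rewrite exprS mulrA dvdp_mull.
by rewrite derivXsubC mul1r dvdp_mull // -scaler_nat dvdpZr ?pnatr_eq0.
Qed.

End SumsOfSquares.

Section ProjectiveValues.
Variables (R : fieldType) (x : R).
Implicit Types p q : {poly R}.
Local Notation Lx := ('X - x%:P).
Local Notation m := (mup x).

(* The hypothesis says that the rational functions [p / q] and [p' / q'] take
   the same value at [x] in the projective line. *)
Lemma same_value_zero p q p' q' : p != 0 -> q != 0 -> p' != 0 -> q' != 0 ->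
  Lx ^+ (minn (m p) (m q) + minn (m p') (m q')).+1 %| p * q' - p' * q ->
  (m q < m p)%N -> (m q' < m p')%N.
Proof.
move=> p0 q0 p'0 q'0 d lt; rewrite ltnNge; apply/negP => le.
(* The hypothesis passes this order on to [p' * q], whose order is exactly [m q + m p']. *)
have d1 : Lx ^+ (m q + m p').+1 %| p * q'.
  by rewrite -mup_geq ?mulf_neq0 // mupM //; lia.
have : Lx ^+ (m q + m p').+1 %| p' * q.
  rewrite -[p' * q](subKr (p * q')) dvdp_sub //.
  by apply: dvdp_trans d; rewrite dvdp_exp2l //; lia.
by rewrite -mup_geq ?mulf_neq0 // mupM //; lia.
Qed.

End ProjectiveValues.

(** * Continued fractions and their values at a point *)

Lemma setD1C (T : finType) (A : {set T}) i j : A :\ i :\ j = A :\ j :\ i.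
Proof. by rewrite !setDDl setUC. Qed.

Section LocalStructure.
Variables (R : rcfType) (T : finType).
Variables (e : rel T) (a : T -> R) (c : T -> T -> R) (eta : {set T} -> {poly R}).
Variable x : R.
Implicit Types (S U : {set T}) (i j u : T).
Hypothesis c_gt0 : forall i j, e i j -> 0 < c i j.
Hypothesis eta_neq0 : forall S, eta S != 0.
Hypothesis eta_rec : forall S i, i \in S ->
  eta S = ('X - (a i)%:P) * eta (S :\ i)
    - \sum_(j in S :\ i | e i j) c i j *: eta (S :\ i :\ j).
Local Notation Lx := ('X - x%:P).
Local Notation m S := (mup x (eta S)).

(** * Wronskians, interlacing and positive vertices *)

Definition wronsk S i : {poly R} :=
  (eta S)^`() * eta (S :\ i) - eta S * (eta (S :\ i))^`().

(** An identity of Christoffel-Darboux type: the square comes from the derivative of ['X - a i], and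
    the other terms in this factor cancel. *)
Lemma wronsk_rec S i : i \in S -> wronsk S i = eta (S :\ i) ^+ 2 +
  \sum_(j in S :\ i | e i j) c i j *: wronsk (S :\ i) j.
Proof.
move=> iS; rewrite /wronsk (eta_rec iS) derivB derivM derivXsubC mul1r.
rewrite raddf_sum /=.
under [in RHS]eq_bigr do rewrite scalerBr.
rewrite sumrB.
under [X in _ = _ + (X - _)]eq_bigr do rewrite scalerAr.
rewrite -mulr_sumr.
under [X in _ = _ + (_ - X)]eq_bigr do rewrite mulrC scalerAl.
rewrite -mulr_suml.
under [X in (_ - X) * _ - _ = _]eq_bigr do rewrite derivZ.
ring.
Qed.

Lemma wronsk_sos S i : i \in S -> sos (wronsk S i).
Proof.
have [n] := ubnP #|S|; elim: n S i => // n IH S i le iS.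
rewrite wronsk_rec //; apply: sosD (sos_sqr _) _.
apply: sos_sum => j /andP[jS eij]; apply: sosZ; first exact/ltW/c_gt0.
by apply: IH jS; move: le; rewrite (cardsD1 i S) iS; lia.
Qed.

Lemma dvdp_wronsk S i : Lx ^+ (m S + m (S :\ i)).-1 %| wronsk S i.
Proof.
have dm S' : Lx ^+ m S' %| eta S' by rewrite -mup_geq.
apply: dvdp_sub.
  apply: (@dvdp_trans _ (Lx ^+ (m S).-1 * Lx ^+ m (S :\ i))).
    by rewrite -exprD dvdp_exp2l //; lia.
  by rewrite dvdp_mul // dvdp_deriv.
apply: (@dvdp_trans _ (Lx ^+ m S * Lx ^+ (m (S :\ i)).-1)).
  by rewrite -exprD dvdp_exp2l //; lia.
by rewrite dvdp_mul // dvdp_deriv.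
Qed.

Lemma dvdp_wronsk_nbr S i j : i \in S -> j \in S :\ i -> e i j ->
  Lx ^+ (m S + m (S :\ i)).-1 %| wronsk (S :\ i) j.
Proof.
move=> iS jS eij; have d := dvdp_wronsk S i.
rewrite wronsk_rec // [_ ^+ 2 + _]addrC in d.
have h k : (k \in S :\ i) && e i k -> sos (wronsk (S :\ i) k).
  by case/andP=> kS _; exact: wronsk_sos.
have c0 k : (k \in S :\ i) && e i k -> 0 < c i k by case/andP=> _ /c_gt0.
apply: (dvdp_sos_sum c0 h _); last by rewrite jS.
apply: dvdp_sosl (sos_sqr _) d; apply: sos_sum => k hk.
by apply: sosZ; [exact/ltW/c0 | exact: h].
Qed.

Lemma dvdp_wronsk_sqr S i n : i \in S -> Lx ^+ n %| wronsk S i ->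
  (uphalf n <= m (S :\ i))%N.
Proof.
move=> iS; rewrite wronsk_rec // => d.
rewrite mup_geq //; apply/dvdp_sqr/(dvdp_sosl (sos_sqr _) _ d).
apply: sos_sum => j /andP[jS eij]; apply: sosZ; first exact/ltW/c_gt0.
exact: wronsk_sos.
Qed.

(** The Wronskian at [j] is a summand of the one at [i], and in turn has [eta (S :\ i :\ j) ^+ 2] as
    a summand. *)
Lemma mult_nbr S i j : i \in S -> j \in S :\ i -> e i j ->
  (uphalf (m S + m (S :\ i)).-1 <= m (S :\ i :\ j))%N.
Proof. by move=> iS jS eij; apply: dvdp_wronsk_sqr => //; exact: dvdp_wronsk_nbr. Qed.

Lemma mult_geq S i n : i \in S -> (n <= m (S :\ i))%N ->
  (forall j, j \in S :\ i -> e i j -> (n <= m (S :\ i :\ j))%N) -> (n <= m S)%N.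
Proof.
move=> iS le h; rewrite mup_geq // (eta_rec iS) dvdp_sub //.
  by rewrite dvdp_mull // -mup_geq.
apply: (big_ind (fun r => Lx ^+ n %| r)) => [||j /andP[jS eij]]; [exact: dvdp0 | exact: dvdp_add |].
by rewrite dvdpZr ?gt_eqF ?c_gt0 // -mup_geq // h.
Qed.

Lemma mult_interlace S i : i \in S ->
  (m S <= (m (S :\ i)).+1)%N /\ (m (S :\ i) <= (m S).+1)%N.
Proof.
move=> iS; split.
  by have := dvdp_wronsk_sqr iS (dvdp_wronsk S i); lia.
rewrite leqNgt; apply/negP => lt.
(* If the multiplicity rose by two or more, [mult_nbr] would give every term of the recurrence for
   [eta S] order at least [(m S).+1]. *)
suff : ((m S).+1 <= m S)%N by rewrite ltnn.
apply: (@mult_geq S i) => [//||j jS eij]; first by lia.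
by have := mult_nbr iS jS eij; lia.
Qed.

(** By [mult_nbr], [m (S :\ i :\ j)] is at least half of [m S + m (S :\ i) - 1], which exceeds
    [m (S :\ i) - 1] unless [m S < m (S :\ i)]. *)
Lemma positive_nbr S i j : i \in S -> j \in S :\ i -> e i j ->
  (m (S :\ i :\ j) < m (S :\ i))%N -> m (S :\ i) = (m S).+1.
Proof.
move=> iS jS eij lt; have := mult_nbr iS jS eij; have := mult_interlace iS; lia.
Qed.

Lemma positive_ex S i : i \in S -> (m S < m (S :\ i))%N ->
  exists j, [/\ j \in S :\ i, e i j & (m (S :\ i :\ j) < m (S :\ i))%N].
Proof.
move=> iS lt.
case: (pickP (fun j => [&& j \in S :\ i, e i j & (m (S :\ i :\ j) < m (S :\ i))%N])).
  by move=> j /and3P[]; exists j.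
move=> h; suff : (m (S :\ i) <= m S)%N by lia.
apply: (@mult_geq S i) => // j jS eij; move: (h j); rewrite jS eij /=; lia.
Qed.

(* Closed form of the Heilmann-Lieb sum, over the paths P from [i] to [u], of
   the squares of [eta (S \ P)] multiplied by the weights of the paths. *)
Definition path_sos S i u : {poly R} :=
  if i == u then eta (S :\ u) ^+ 2
  else eta (S :\ i) * eta (S :\ u) - eta S * eta (S :\ i :\ u).

Lemma path_sos_rec S i u : i \in S -> u \in S :\ i ->
  path_sos S i u = \sum_(j in S :\ i | e i j) c i j *: path_sos (S :\ i) j u.
Proof.
move=> iS uS; have := uS; rewrite in_setD1 => /andP[nui uS'].
have iSu : i \in S :\ u by rewrite in_setD1 eq_sym nui iS.
rewrite /path_sos [i == u]eq_sym (negbTE nui) (eta_rec iS) (eta_rec iSu).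
have Eu : S :\ u :\ i = S :\ i :\ u by rewrite setD1C.
rewrite Eu.
set A := eta (S :\ i); set B := eta (S :\ i :\ u).
transitivity ((\sum_(j in S :\ i | e i j) c i j *: eta (S :\ i :\ j)) * B
   - A * (\sum_(j in S :\ i :\ u | e i j) c i j *: eta (S :\ i :\ u :\ j))).
  by ring.
rewrite mulr_suml mulr_sumr.
(* Padding with zero at [j = u] leaves there only the square, the contribution of the one-edge
   path. *)
have -> : \sum_(j in S :\ i :\ u | e i j) A * (c i j *: eta (S :\ i :\ u :\ j))
  = \sum_(j in S :\ i | e i j) (if j == u then 0 else A * (c i j *: eta (S :\ i :\ u :\ j))).
  rewrite [RHS](bigID (pred1 u)) /= [X in _ = X + _]big1 ?add0r => [|j /andP[_ ->]//].
  by apply: eq_big => [j|j /andP[]]; rewrite !inE; [lia | case: (j == u)].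
rewrite -sumrB; apply: eq_bigr => j _; case: eqP => [->|_].
  by rewrite subr0 -scalerAl expr2.
rewrite -scalerAl -scalerAr -scalerBr [_ :\ u :\ j]setD1C.
by congr (_ *: (_ - _)); rewrite mulrC.
Qed.

Lemma path_sos_sos S i u : i \in S -> u \in S -> sos (path_sos S i u).
Proof.
have [n] := ubnP #|S|; elim: n S i => // n IH S i le iS uS.
have [->|niu] := eqVneq i u; first by rewrite /path_sos eqxx; exact: sos_sqr.
have uS' : u \in S :\ i by rewrite in_setD1 eq_sym niu.
rewrite path_sos_rec //; apply: sos_sum => j /andP[jS eij].
apply: sosZ; first exact/ltW/c_gt0.
by apply: IH => //; move: le; rewrite (cardsD1 i S) iS; lia.
Qed.

Lemma dvdp_path_sos S i u j n : i \in S -> u \in S :\ i ->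
  Lx ^+ n %| path_sos S i u -> j \in S :\ i -> e i j ->
  Lx ^+ n %| path_sos (S :\ i) j u.
Proof.
move=> iS uS; rewrite path_sos_rec // => d jS eij.
have c0 k : (k \in S :\ i) && e i k -> 0 < c i k by case/andP=> _ /c_gt0.
have h k : (k \in S :\ i) && e i k -> sos (path_sos (S :\ i) k u).
  by case/andP=> kS _; exact: path_sos_sos.
by apply: (dvdp_sos_sum c0 h d); rewrite jS.
Qed.

(** * Continued fractions before and after deleting vertices *)

Definition eta_cross S S' i : {poly R} :=
  eta S * eta (S' :\ i) - eta S' * eta (S :\ i).

(* [eta S / eta (S :\ i)] and [eta S' / eta (S' :\ i)] take the same value at
   [x] in the projective line. *)
Definition same_value S S' i :=
  Lx ^+ (minn (m S) (m (S :\ i)) + minn (m S') (m (S' :\ i))).+1 %| eta_cross S S' i.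

(** Being essential means that the continued fraction at [i] takes the value zero at [x]. *)
Lemma same_value_essential S S' i : same_value S S' i ->
  (m (S :\ i) < m S)%N -> (m (S' :\ i) < m S')%N.
Proof. exact: same_value_zero. Qed.

Lemma same_value_sym S S' i : same_value S S' i -> same_value S' S i.
Proof.
by rewrite /same_value addnC -dvdpNr /eta_cross opprB.
Qed.

(** Neighbours of [i] in [U] occur only in the recurrence for [S], whence the unpaired second
    sum. *)
Lemma eta_cross_rec S U i : i \in S -> U \subset S :\ i ->
  eta_cross S (S :\: U) i =
  \sum_(j in S :\ i :\: U | e i j) c i j *: eta_cross (S :\ i) (S :\ i :\: U) j
  - \sum_(j in U | e i j) c i j *: (eta (S :\ i :\ j) * eta (S :\ i :\: U)).
Proof.
move=> iS US; have iU : i \notin U by move: US; rewrite subsetD1 => /andP[].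
have iSU : i \in S :\: U by rewrite inE iU.
have E : S :\: U :\ i = S :\ i :\: U by rewrite !setDDl setUC.
rewrite /eta_cross (eta_rec iS) (eta_rec iSU) E.
set A := eta (S :\ i); set A' := eta (S :\ i :\: U).
transitivity ((\sum_(j in S :\ i :\: U | e i j) c i j *: eta (S :\ i :\: U :\ j)) * A
  - (\sum_(j in S :\ i | e i j) c i j *: eta (S :\ i :\ j)) * A').
  by ring.
rewrite [X in _ - X * _](bigID [in U]) /=.
rewrite [X in (X + _) * _](eq_bigl (fun j => (j \in U) && e i j)); last first.
  by move=> j; rewrite andbAC; case: (boolP (j \in U)) => [/(subsetP US)->|]; rewrite ?andbF.
rewrite [X in (_ + X) * _](eq_bigl (fun j => (j \in S :\ i :\: U) && e i j)); last first.
  by move=> j; rewrite [in RHS]in_setD; case: (j \in U); rewrite /= ?andbF ?andbT.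
rewrite mulrDl opprD addrA addrAC -addrA [in LHS]addrA !mulr_suml -sumrB.
congr (_ - _); last by apply: eq_bigr => j _; rewrite -scalerAl.
by apply: eq_bigr => j _; rewrite -!scalerAl -scalerBr mulrC; congr (_ *: (_ - _)); rewrite mulrC.
Qed.

(* Following the paths from [i] to [U]: those whose deletion leaves a
   polynomial of high order at [x] do not contribute to the value at [x] of
   the continued fraction [eta S / eta (S :\ i)]. *)
Lemma same_value_setD n S U i : i \in S -> U \subset S :\ i ->
  (forall u, u \in U -> Lx ^+ n.*2.+1 %| path_sos S i u) ->
  (minn (m S) (m (S :\ i)) <= n)%N -> same_value S (S :\: U) i.
Proof.
have [k] := ubnP #|S|; elim: k S i => // k IH S i lek iS US hU len.
have iU : i \notin U by move: US; rewrite subsetD1 => /andP[].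
have E : S :\: U :\ i = S :\ i :\: U by rewrite !setDDl setUC.
have iSU : i \in S :\: U by rewrite inE iU.
set A := S :\ i; set A' := S :\ i :\: U.
rewrite -/A in len.
(* For the path consisting of the edge [ij], the square of [eta (A :\ j)] has order at least
   [2n + 1], hence at least [2n + 2]. *)
have hUnbr j : j \in U -> e i j -> (n < m (A :\ j))%N.
  move=> jU eij; have jA := subsetP US j jU.
  have := dvdp_path_sos iS jA (hU j jU) jA eij.
  by rewrite /path_sos eqxx => /dvdp_sqr; rewrite -mup_geq // uphalfE /= doubleK.
have IHA j : j \in A -> j \notin U -> e i j ->
    (minn (m A) (m (A :\ j)) <= n)%N -> same_value A A' j.
  move=> jA jU eij le; apply: IH => //.
  - by move: lek; rewrite (cardsD1 i S) iS -/A; lia.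
  - by rewrite subsetD1 US jU.
  - by move=> u uU; apply: dvdp_path_sos (hU u uU) jA eij => //; exact: (subsetP US).
(* Without a pole at [x], no neighbour of [i] is essential in [A], so the reciprocals in the
   recurrence are finite and can be compared term by term. *)
have [leA|ltA] := leqP (m A) (m S).
  have nbrA j : j \in A -> e i j -> (m A <= m (A :\ j))%N.
    move=> jA eij; rewrite leqNgt; apply/negP => lt.
    by have := positive_nbr iS jA eij lt; rewrite -/A; lia.
  rewrite /same_value eta_cross_rec // E -/A -/A'.
  apply: dvdp_sub.
    apply: (big_ind (fun r => Lx ^+ _ %| r)) => [||j /andP[jA' eij]];
      [exact: dvdp0 | exact: dvdp_add |].
    have /setDP[jA jU] := jA'.
    rewrite dvdpZr ?gt_eqF ?c_gt0 //.
    have sv : same_value A A' j by apply: IHA => //; lia.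
    have nbrA' : (m A' <= m (A' :\ j))%N.
      rewrite leqNgt; apply/negP => /(same_value_essential (same_value_sym sv)).
      by rewrite ltnNge nbrA.
    apply: dvdp_trans sv; rewrite dvdp_exp2l // ltnS.
    by have := nbrA j jA eij; lia.
  apply: (big_ind (fun r => Lx ^+ _ %| r)) => [||j /andP[jU eij]];
    [exact: dvdp0 | exact: dvdp_add |].
  rewrite dvdpZr ?gt_eqF ?c_gt0 // -mup_geq ?mulf_neq0 // mupM //.
  by have := hUnbr j jU eij; rewrite -/A'; lia.
(* A pole comes from a neighbour [j] that is essential in [A]. It lies outside [U] and stays
   essential in [A'] by induction, so the pole persists. *)
have [j [jA eij lt]] := positive_ex iS ltA.
rewrite -/A in jA lt.
have [_ EA] := mult_interlace iS; rewrite -/A in EA.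
have jU : j \notin U by apply/negP => /hUnbr/(_ eij); lia.
have sv : same_value A A' j by apply: IHA => //; lia.
have ltA' := same_value_essential sv lt.
have jA' : j \in A' by rewrite inE jU.
rewrite /A' -E in jA' ltA'.
have := positive_nbr iSU jA' eij ltA'; rewrite E -/A' => EA'.
rewrite /same_value /eta_cross E -/A -/A' EA' (minn_idPl (ltnW ltA)) (minn_idPl (leqnSn _)).
by apply: dvdp_sub; rewrite -mup_geq ?mulf_neq0 // mupM // ?EA'; clear -ltA; lia.
Qed.

(** With [n = m (S :\ z) = m S - 1], interlacing and the non-essential [u] give both products in
    [path_sos S z u] order at least [2 * m S - 1 = 2n + 1]. *)
Lemma essential_setD S U z : z \in S -> U \subset S :\ z ->
  (m (S :\ z) < m S)%N -> (forall u, u \in U -> (m S <= m (S :\ u))%N) ->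
  (m (S :\: U :\ z) < m (S :\: U))%N.
Proof.
move=> zS US lt hU; have [Ez _] := mult_interlace zS.
apply: (same_value_essential _ lt); apply: (@same_value_setD (m (S :\ z))) => // [u uU|].
  have := subsetP US u uU; rewrite in_setD1 => /andP[nuz uS].
  have zSu : z \in S :\ u by rewrite in_setD1 eq_sym nuz.
  have [le _] := mult_interlace zSu; rewrite setD1C in le.
  have := hU u uU; rewrite /path_sos eq_sym (negbTE nuz) => le2.
  by apply: dvdp_sub; rewrite -mup_geq ?mulf_neq0 // mupM //; lia.
exact: geq_minr.
Qed.

Lemma stability S u z v : u \in S -> z \in S -> e u z ->
  (m (S :\ z) < m S)%N -> (m S <= m (S :\ u))%N -> v \in S :\ u ->
  (m (S :\ u :\ v) < m (S :\ u))%N = (m (S :\ v) < m S)%N.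
Proof.
move=> uS zS euz ltz leu vSu.
have nzu : z != u by apply: contraTneq ltz => ->; rewrite -leqNgt.
have zSu : z \in S :\ u by rewrite in_setD1 nzu.
have pos_u : m (S :\ u) = (m S).+1.
  apply: (positive_nbr uS zSu euz); apply: essential_setD => // [|w].
    by rewrite sub1set in_setD1 eq_sym nzu.
  by rewrite inE => /eqP ->.
have [nvu vS] := setD1P vSu.
have uSv : u \in S :\ v by rewrite in_setD1 eq_sym nvu.
have [] := mult_interlace vSu; have [] := mult_interlace uSv.
have [] := mult_interlace vS; rewrite (setD1C S v u).
(* If [v] is essential in [S], deleting [u] from [S :\ v] brings the multiplicity up to at most
   [m S], below [m (S :\ u)]. *)
case: (ltnP (m (S :\ v)) (m S)) => [|lev _ _ _ _ _ _]; first by clear -pos_u; lia.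
have nzv : z != v by apply: contraTneq ltz => ->; rewrite -leqNgt.
have zSvu : z \in S :\ v :\ u by rewrite !in_setD1 nzu nzv.
suff /(positive_nbr uSv zSvu euz) : (m (S :\ v :\ u :\ z) < m (S :\ v :\ u))%N.
  by rewrite (setD1C S v u) pos_u => ->; rewrite ltnS ltnNge lev.
rewrite [S :\ v :\ u]setDDl; apply: essential_setD => // [|w].
  by rewrite subUset !sub1set !in_setD1 [v == z]eq_sym [u == z]eq_sym nzu nzv uS vS.
by case/set2P => ->.
Qed.

End LocalStructure.

(** Field morphisms preserve and reflect divisibility, so a multiplicity over [R[i]] can be computed
    over [R]. *)
Lemma mup_map (F F' : fieldType) (f : {rmorphism F -> F'}) (x : F) (p : {poly F}) :
  p != 0 -> mup (f x) (map_poly f p) = mup x p.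
Proof.
move=> p0; have dE n : (n <= mup (f x) (map_poly f p))%N = (n <= mup x p)%N.
  rewrite !mup_geq ?map_poly_eq0 // -(dvdp_map f) rmorphXn rmorphB /=.
  by rewrite map_polyX map_polyC.
by apply/eqP; rewrite eqn_leq -dE leqnn dE leqnn.
Qed.

(** * Descent to real polynomials *)

Section Complexification.
Variables (R : realType) (T : finType) (e : rel T).
Variables (w : {set T} -> R[i]) (w1 : T -> R).

(** The squared modulus as an element of [R]; the norm on [R[i]] takes its values in [R[i]]. *)
Definition sqnorm (A : {set T}) : R := complex.Re (w A) ^+ 2 + complex.Im (w A) ^+ 2.

Lemma eta_wE S :
  eta_w e w w1 S = map_poly (real_complex R) (wmatching_poly e sqnorm w1 S).
Proof.
rewrite rmorph_sum; apply: eq_bigr => S' _.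
rewrite /= map_polyZ /vweight rmorphM rmorphXn rmorphN1 rmorph_prod; congr (_ *: _).
rewrite rmorph_sum; apply: eq_bigr => M _.
rewrite /= map_polyZ map_polyXn rmorphM rmorphXn rmorphN1 rmorph_prod.
by congr (_ * _ *: _); apply: eq_bigr => A _; rewrite -add_Re2_Im2.
Qed.

Lemma sqnorm_gt0 A : w A != 0 -> 0 < sqnorm A.
Proof.
move=> wA; have : 0 < `|w A| ^+ 2 by rewrite exprn_gt0 ?normr_gt0.
by rewrite -add_Re2_Im2 ltcR.
Qed.

End Complexification.

Theorem theorem5p11 (R : realType) (T : finType) (e : rel T)
    (e_sym : symmetric e) (e_irr : irreflexive e)
    (w : {set T} -> R[i]) (w_nz : forall A : {set T}, is_edge e A -> w A != 0)
    (w1 : T -> R) (theta : R) (u : T) :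
  special e w w1 theta [set: T] u ->
  forall v : T, v \in [set: T] :\ u ->
    (essential e w w1 theta ([set: T] :\ u) v <-> essential e w w1 theta [set: T] v).
Proof.
have eta0 S : wmatching_poly e (sqnorm w) w1 S != 0.
  by rewrite -size_poly_eq0 size_wmatching_poly.
have c_gt0 i j : e i j -> 0 < sqnorm w [set i; j].
  by move=> eij; apply/sqnorm_gt0/w_nz/is_edge_set2.
have eta_rec S i := wmatching_poly_rec e_sym e_irr (sqnorm w) w1 (S := S) (u := i).
have multE S : mult e w w1 theta S = mup theta (wmatching_poly e (sqnorm w) w1 S).
  by rewrite /mult eta_wE mup_map.
(* By interlacing, a drop in multiplicity is a drop by exactly one. *)
have essE (S : {set T}) v : v \in S -> essential e w w1 theta S v =
    (mup theta (wmatching_poly e (sqnorm w) w1 (S :\ v)) <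
     mup theta (wmatching_poly e (sqnorm w) w1 S))%N.
  move=> vS; rewrite /essential vS !multE /=.
  have [le _] := mult_interlace theta c_gt0 eta0 eta_rec vS.
  by rewrite eqn_leq le andbT.
case/and3P=> uS; rewrite essE // -leqNgt => leu /exists_inP[z zS /andP[euz]].
rewrite essE // => ltz v vSu; rewrite !essE //.
by rewrite (stability c_gt0 eta0 eta_rec uS zS euz ltz leu vSu).
Qed.
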